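(* Every self-full co-ceer-resistant ceer is hereditarily self-full.
   Context: A ceer is a computably enumerable equivalence relation on $\omega$. A computable reduction of an equivalence relation $R$ to $S$ is a total computable $f$ with $x\,R\,y \Leftrightarrow f(x)\,S\,f(y)$. A ceer $R$ is self-full if every computable reduction $f$ of $R$ to $R$ has range intersecting every $R$-equivalence class. The uniform join is $R\oplus S=\{(2x,2y):(x,y)\in R\}\cup\{(2x+1,2y+1):(x,y)\in S\}$. A ceer $X$ is hereditarily self-full if $X\oplus Y$ is self-full for every self-full ceer $Y$. A ceer $X$ is co-ceer-resistant if for every $\Pi^0_1$ equivalence relation $C$ on $\omega$ with infinitely many classes there are $x,y$ with $x\,X\,y$ and not $x\,C\,y$. *)

(* Defs.v *)
From mathcomp Require Import all_boot.
From mathcomp Require Import boolp classical_sets functions cardinality.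
From Corelib Require Import RelationClasses.
Set Implicit Arguments.
Unset Strict Implicit.
Unset Printing Implicit Defensive.
Local Open Scope classical_set_scope.

(* Total computable functions: the least class containing the initial         *)
(* functions and closed under composition, primitive recursion and            *)
(* minimization of regular functions (those for which the search always       *)
(* succeeds). The last two clauses are stated by the equations characterizing *)
(* f, so the class is closed under pointwise equality.                        *)
Inductive computable : forall k : nat, (k.-tuple nat -> nat) -> Prop :=
| computable_zero k : computable (fun _ : k.-tuple nat => 0)
| computable_succ : computable (fun v : 1.-tuple nat => (thead v).+1)
| computable_proj k (i : 'I_k) : computable (fun v : k.-tuple nat => tnth v i)
| computable_comp k l (h : l.-tuple nat -> nat) (g : 'I_l -> k.-tuple nat -> nat) :
    computable h -> (forall i, computable (g i)) ->
    computable (fun v : k.-tuple nat => h [tuple g i v | i < l])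
| computable_primrec k (g : k.-tuple nat -> nat) (h : k.+2.-tuple nat -> nat)
    (f : k.+1.-tuple nat -> nat) :
    computable g -> computable h ->
    (forall v : k.-tuple nat, f [tuple of 0 :: v] = g v) ->
    (forall n (v : k.-tuple nat),
       f [tuple of n.+1 :: v] = h [tuple of n :: f [tuple of n :: v] :: v]) ->
    computable f
| computable_mu k (g : k.+1.-tuple nat -> nat) (f : k.-tuple nat -> nat) :
    computable g ->
    (forall v : k.-tuple nat, g [tuple of f v :: v] = 0) ->
    (forall (v : k.-tuple nat) m, m < f v -> g [tuple of m :: v] <> 0) ->
    computable f.

Definition computable1 (f : nat -> nat) : Prop :=
  computable (fun v : 1.-tuple nat => f (thead v)).

(* Empty, or the range of the computable function n |-> (f n, g n). *)
Definition ce_rel (R : nat -> nat -> Prop) : Prop :=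
  (forall x y, ~ R x y) \/
  exists f g : nat -> nat, [/\ computable1 f, computable1 g &
    forall x y, R x y <-> exists n, f n = x /\ g n = y].

(* The matrix P is a computable predicate: its 0/1-valued characteristic      *)
(* function is computable.                                                    *)
Definition Pi01_rel (R : nat -> nat -> Prop) : Prop :=
  exists P : 3.-tuple nat -> bool,
    computable (fun v => nat_of_bool (P v)) /\
    forall x y, R x y <-> forall z, P [tuple x; y; z].

Definition ceer (R : nat -> nat -> Prop) : Prop := Equivalence R /\ ce_rel R.

Definition co_ceer (C : nat -> nat -> Prop) : Prop :=
  Equivalence C /\ Pi01_rel C.

Definition infinitely_many_classes (C : nat -> nat -> Prop) : Prop :=
  infinite_set (range (fun x : nat => [set y : nat | C x y])).

Definition reduction (f : nat -> nat) (R S : nat -> nat -> Prop) : Prop :=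
  computable1 f /\ forall x y, R x y <-> S (f x) (f y).

Definition self_full (R : nat -> nat -> Prop) : Prop :=
  forall f, reduction f R R -> forall x, exists n, R x (f n).

Definition ujoin (R S : nat -> nat -> Prop) (a b : nat) : Prop :=
  (exists x y, [/\ a = 2 * x, b = 2 * y & R x y]) \/
  (exists x y, [/\ a = 2 * x + 1, b = 2 * y + 1 & S x y]).

Definition hereditarily_self_full (X : nat -> nat -> Prop) : Prop :=
  forall Y, ceer Y -> self_full Y -> self_full (ujoin X Y).

Definition co_ceer_resistant (X : nat -> nat -> Prop) : Prop :=
  forall C, co_ceer C -> infinitely_many_classes C ->
    exists x y, X x y /\ ~ C x y.

(* Main.v *)
Require Import Defs.
From mathcomp Require Import all_boot zify.
From mathcomp Require Import boolp classical_sets functions cardinality.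
From Corelib Require Import RelationClasses.
Set Implicit Arguments.
Unset Strict Implicit.
Unset Printing Implicit Defensive.
Local Open Scope classical_set_scope.

(** Let [f] reduce X + Y to itself. The relation "the f-orbits of 2x and 2y have
    the same sequence of parities" is a co-ceer containing X, so by resistance
    it has finitely many classes; hence the set D of all x such that the orbit
    of 2x never leaves X is decidable. As [f] maps D to itself, [f] on D extended
    by the identity reduces X to X, so [f] is onto the classes of D. Therefore
    no orbit starting in Y stays in X from its second point on, and the first
    return map Y -> Y is a total computable reduction, hence onto the classes
    of Y. Finally the orbit of 2x with x outside D enters Y; pulling back the
    class of its entry point through the first return map yields a preimage of
    the class of 2x. *)

(** * Closure properties of computable functions *)

Lemma computable_comp1 k (h : nat -> nat) (a : k.-tuple nat -> nat) :
  computable1 h -> computable a -> computable (fun v => h (a v)).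
Proof.
move=> ch ca.
have := @computable_comp k 1 _ (fun=> a) ch (fun=> ca).
by congr computable; apply: funext => v; rewrite /thead tnth_mktuple.
Qed.

Lemma computable_behead k (g : k.-tuple nat -> nat) :
  computable g -> computable (fun v : k.+1.-tuple nat => g (behead_tuple v)).
Proof.
move=> cg.
have := computable_comp cg (fun i : 'I_k => computable_proj (lift ord0 i)).
congr computable; apply: funext => v; congr g; apply: eq_from_tnth => i.
rewrite tnth_mktuple tnth_behead; congr (tnth v _); apply: val_inj.
by rewrite /= inordK // ltnS.
Qed.

Lemma computable_thead k : computable (fun v : k.+1.-tuple nat => thead v).
Proof. exact: computable_proj. Qed.

Lemma computable_S k (a : k.-tuple nat -> nat) :
  computable a -> computable (fun v => (a v).+1).
Proof. exact: (computable_comp1 computable_succ). Qed.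

Lemma behead_tuple_cons k n (v : k.-tuple nat) :
  behead_tuple [tuple of n :: v] = v.
Proof. exact: val_inj. Qed.

(** The working form of primitive recursion: the recursion argument is curried and may be any
    computable [a], by composing the tuple version with [v |-> a v :: v]. *)
Lemma computable_rec k (F : nat -> k.-tuple nat -> nat)
    (H : nat -> nat -> k.-tuple nat -> nat) (a : k.-tuple nat -> nat) :
  computable (F 0) ->
  computable (fun v : k.+2.-tuple nat =>
    H (thead v) (thead (behead_tuple v)) (behead_tuple (behead_tuple v))) ->
  (forall n v, F n.+1 v = H n (F n v) v) ->
  computable a -> computable (fun v => F (a v) v).
Proof.
move=> cF cH FS ca.
have cFb : computable (fun w : k.+1.-tuple nat => F (thead w) (behead_tuple w)).
  apply: (computable_primrec cF cH) => [v | n v]; rewrite !behead_tuple_cons ?theadE //.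
pose b (i : 'I_k.+1) (v : k.-tuple nat) := tnth [tuple of a v :: v] i.
have cb i : computable (b i).
  case: (unliftP ord0 i) => [j|] ->; rewrite /b.
  - have := computable_proj j.
    by congr computable; apply: funext => v; rewrite tnthS.
  - by have := ca; congr computable; apply: funext => v; rewrite tnth0.
have := computable_comp cFb cb.
congr computable; apply: funext => v.
have -> : [tuple b i v | i < k.+1] = [tuple of a v :: v].
  by apply: eq_from_tnth => i; rewrite tnth_mktuple.
by rewrite behead_tuple_cons.
Qed.

Lemma computable_if k (b : k.-tuple nat -> bool) (u w : k.-tuple nat -> nat) :
  computable (fun v => b v : nat) -> computable u -> computable w ->
  computable (fun v => if b v then u v else w v).
Proof.
move=> cb cu cw.
have cH := computable_behead (computable_behead cu).
(* A case distinction is a recursion on the 0/1 value of [b], with base [w] and constant step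
   [u]. *)
have := @computable_rec _ (fun n v => if n is 0 then w v else u v)
  (fun _ _ v => u v) _ cw cH (fun _ _ => erefl) cb.
by congr computable; apply: funext => v; case: (b v).
Qed.

Lemma computable_bool k (b : bool) : computable (fun _ : k.-tuple nat => b : nat).
Proof.
case: b; last exact: computable_zero.
exact: computable_S (computable_zero k).
Qed.

Lemma computable_negb k (b : k.-tuple nat -> bool) :
  computable (fun v => b v : nat) -> computable (fun v => ~~ b v : nat).
Proof.
move=> cb; have := computable_if cb (computable_bool k false) (computable_bool k true).
by congr computable; apply: funext => v; case: (b v).
Qed.

Lemma computable_andb k (b c : k.-tuple nat -> bool) :
  computable (fun v => b v : nat) -> computable (fun v => c v : nat) ->
  computable (fun v => b v && c v : nat).
Proof.
move=> cb cc; have := computable_if cb cc (computable_bool k false).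
by congr computable; apply: funext => v; case: (b v).
Qed.

Lemma computable_eqb k (b c : k.-tuple nat -> bool) :
  computable (fun v => b v : nat) -> computable (fun v => c v : nat) ->
  computable (fun v => (b v == c v) : nat).
Proof.
move=> cb cc; have := computable_if cb cc (computable_negb cc).
by congr computable; apply: funext => v; case: (b v); case: (c v).
Qed.

(** No uniformity in [n] is asked of [p]: as [s] is fixed, this is a finite conjunction. *)
Lemma computable_all k (p : nat -> k.-tuple nat -> bool) (s : seq nat) :
  (forall n, computable (fun v => p n v : nat)) ->
  computable (fun v => all (p^~ v) s : nat).
Proof.
move=> cp; elim: s => [|n s IHs]; first exact: computable_bool.
exact: (computable_andb (cp n) IHs).
Qed.

Lemma computable_iter k (f : nat -> nat) (a b : k.-tuple nat -> nat) :
  computable1 f -> computable a -> computable b ->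
  computable (fun v => iter (a v) f (b v)).
Proof.
move=> cf ca cb.
apply: (@computable_rec k (fun n v => iter n f (b v)) (fun _ r _ => f r)) => //.
apply: (computable_comp1 cf).
exact: computable_behead (computable_thead k).
Qed.

Lemma computable_addn k (a b : k.-tuple nat -> nat) :
  computable a -> computable b -> computable (fun v => a v + b v).
Proof.
move=> ca cb; have := computable_iter computable_succ ca cb.
by congr computable; apply: funext => v; rewrite iter_succn addnC.
Qed.

Lemma computable_mul2n k (a : k.-tuple nat -> nat) :
  computable a -> computable (fun v => 2 * a v).
Proof.
move=> ca; have := computable_addn ca ca.
by congr computable; apply: funext => v; rewrite mul2n addnn.
Qed.

Lemma computable_odd k (a : k.-tuple nat -> nat) :
  computable a -> computable (fun v => odd (a v) : nat).
Proof.
move=> ca.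
(* The parity of [n] is the [n]-th iterate of [b |-> 1 - b] at 0. *)
have c1B : computable1 (subn 1).
  apply: (@computable_rec 1 (fun n _ => 1 - n) (fun _ _ _ => 0)).
  - exact: computable_bool true.
  - exact: computable_zero.
  - by [].
  - exact: computable_thead.
have := computable_iter c1B ca (computable_zero k).
congr computable; apply: funext => v.
by elim: (a v) => //= n ->; case: (odd n).
Qed.

Lemma computable_half k (a : k.-tuple nat -> nat) :
  computable a -> computable (fun v => (a v)./2).
Proof.
apply: (@computable_rec _ (fun n _ => n./2) (fun n r _ => odd n + r)).
- exact: computable_zero.
- apply: computable_addn; first exact: computable_odd (computable_thead _).
  exact: computable_behead (computable_thead _).
- by move=> n _; rewrite -uphalf_half.
Qed.

(** * Orbits of self-reductions of a uniform join *)

Lemma ujoinE X Y a b :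
  ujoin X Y a b <-> odd a = odd b /\ (if odd a then Y else X) a./2 b./2.
Proof.
split=> [[] [x [y [-> -> xy]]]|[]].
- by rewrite !mul2n !odd_double !doubleK.
- by rewrite !mul2n !addn1 /= !odd_double /= !uphalf_double.
- move: (odd_double_half a) (odd_double_half b) => aE bE ab.
  rewrite -ab -!mul2n in bE aE; case: (odd a) aE bE => /= aE bE xy.
  - by right; exists a./2, b./2; rewrite ![_ + 1]addnC; split.
  - by left; exists a./2, b./2; split.
Qed.

Lemma ujoin_odd X Y a b : ujoin X Y a b -> odd a = odd b.
Proof. by case/ujoinE. Qed.

Lemma ujoin_even X Y x y : ujoin X Y (2 * x) (2 * y) <-> X x y.
Proof. by rewrite ujoinE !mul2n !odd_double !doubleK; split=> [[]|]. Qed.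

Lemma ujoin_succ_double X Y x y :
  ujoin X Y (2 * x + 1) (2 * y + 1) <-> Y x y.
Proof.
by rewrite ujoinE !mul2n !addn1 /= !odd_double /= !uphalf_double; split=> [[]|].
Qed.

Lemma ujoin_equiv X Y :
  Equivalence X -> Equivalence Y -> Equivalence (ujoin X Y).
Proof.
case=> rX sX tX [rY sY tY]; split=> [a|a b|a b c].
- by apply/ujoinE; split=> //; case: odd.
- move=> /ujoinE[ab h]; apply/ujoinE; split=> //; rewrite -ab.
  by move: h; case: odd => [/sY|/sX].
- move=> /ujoinE[ab h] /ujoinE[bc h']; apply/ujoinE; split; first by rewrite ab.
  move: h h'; rewrite -ab.
  by case: odd => [/tY|/tX]; apply.
Qed.

Lemma reduction_iter f (R : nat -> nat -> Prop) n x y :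
  reduction f R R -> R x y <-> R (iter n f x) (iter n f y).
Proof. by case=> _ fR; elim: n => //= n IHn; rewrite -fR. Qed.

(** The list [s] holds one escape time for each class of [C] that escapes. All members of a class
    share their parities, so checking these times settles every orbit. *)
Lemma finite_even_test X Y f :
  co_ceer_resistant X -> reduction f (ujoin X Y) (ujoin X Y) ->
  exists s : seq nat, forall x, all (fun n => ~~ odd (iter n f (2 * x))) s ->
    forall n, ~~ odd (iter n f (2 * x)).
Proof.
move=> resX fR.
pose C x y := forall n, odd (iter n f (2 * x)) = odd (iter n f (2 * y)).
have cC : co_ceer C.
  split; first by split=> [x|x y xy|x y z xy yz] n //; rewrite xy.
  exists (fun v => odd (iter (tnth v (inord 2)) f (2 * tnth v (inord 0))) ==
                   odd (iter (tnth v (inord 2)) f (2 * tnth v (inord 1)))).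
  split.
    by apply: computable_eqb; apply: computable_odd;
       apply: (computable_iter fR.1) (computable_mul2n _);
       exact: computable_proj.
  move=> x y; split=> [xy z|xy n]; [apply/eqP|move/eqP: (xy n)];
    by rewrite !(tnth_nth 0) /= !inordK.
have [|] := pselect (infinitely_many_classes C).
  move=> /(resX _ cC)[x [y [xy]]] [] n.
  by apply: (@ujoin_odd X Y); apply/(reduction_iter n _ _ fR).1/ujoin_even.
move=> /contrapT finC.
(* An escape time of the class [c]. The default 0 for classes that never escape only adds a harmless
   check to [s]. *)
pose K (c : set nat) := xget 0 [set n | exists2 x, c x & odd (iter n f (2 * x))].
have /finite_seqP[s Ks] := finite_image K finC.
exists s => x /allP even_x n; apply/negP => odd_n.
set c := [set y | C x y].
have [y xy odd_y] : exists2 y, C x y & odd (iter (K c) f (2 * y)).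
  by apply: (@xgetI _ 0 [set m | exists2 y, C x y & odd (iter m f (2 * y))] n);
     exists x.
have : (K @` range (fun x => [set y | C x y])) (K c) by exists c => //; exists x.
by rewrite Ks => /even_x; rewrite xy odd_y.
Qed.

Theorem mainTheorem2 (X : nat -> nat -> Prop) :
  ceer X -> self_full X -> co_ceer_resistant X -> hereditarily_self_full X.
Proof.
move=> [eqX _] sfX resX Y [eqY _] sfY f fR.
have eqR := ujoin_equiv eqX eqY.
set R := ujoin X Y in fR eqR *.
have [cf fP] := fR.
have evenE a : ~~ odd a -> 2 * a./2 = a by rewrite mul2n; exact: even_halfK.
have oddE a : odd a -> 2 * a./2 + 1 = a by move=> oa; rewrite mul2n addn1 odd_halfK // prednK // odd_gt0.
have odd1 y : odd (2 * y + 1) by rewrite mul2n addn1 /= odd_double.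
have even0 x : ~~ odd (2 * x) by rewrite mul2n odd_double.
have evenR x y : X x y <-> R (2 * x) (2 * y) by apply: iff_sym; exact: ujoin_even.
have succR x y : Y x y <-> R (2 * x + 1) (2 * y + 1).
  by apply: iff_sym; exact: ujoin_succ_double.
have iterR n a b : R a b -> R (iter n f a) (iter n f b).
  exact: (reduction_iter n _ _ fR).1.
have [s sP] := finite_even_test resX fR.
pose D x := all (fun n => ~~ odd (iter n f (2 * x))) s.
have DP x : reflect (forall n, ~~ odd (iter n f (2 * x))) (D x).
  by apply: (iffP idP) => [/sP|ev] //; apply/allP => n _.
have DX x y : X x y -> D x = D y.
  move=> /evenR xy.
  by apply: eq_all => n; rewrite (ujoin_odd (iterR n _ _ xy)).
pose g x := if D x then (f (2 * x))./2 else x.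
have gE x : D x -> 2 * g x = f (2 * x).
  by move=> Dx; rewrite /g Dx evenE //; apply: (DP _ Dx 1).
have Dg x : D x -> D (g x).
  by move=> Dx; apply/DP => n; rewrite gE // -iterSr; exact: DP.
have gR : reduction g X X.
  split.
    apply: computable_if (computable_thead _).
      apply: (computable_all (p := fun n v => ~~ odd (iter n f (2 * thead v)))) => n.
      apply/computable_negb/computable_odd/computable_iter => //.
        by elim: n => [|n]; [exact: computable_zero|exact: computable_S].
      exact: computable_mul2n (computable_thead _).
    apply/computable_half/(computable_comp1 cf)/computable_mul2n.
    exact: computable_thead.
  (* In the mixed cases both sides fail: [D] is invariant under [X], and [g] preserves both [D] and
     its complement. *)
  move=> x y; case Dx: (D x); case Dy: (D y).
  - by rewrite (evenR x) (evenR (g x)) !gE.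
  - split=> [/DX|/DX]; first by rewrite Dx Dy.
    by rewrite (Dg _ Dx) {1}/g Dy Dy.
  - split=> [/DX|/DX]; first by rewrite Dx Dy.
    by rewrite (Dg _ Dy) {1}/g Dx Dx.
  - by rewrite /g Dx Dy.
have ontoD x : D x -> exists n, R (2 * x) (f (2 * n)).
  move=> Dx; have [n xgn] := sfX _ gR x; exists n.
  (* Outside [D] the map [g] is the identity, so it could not send [n] to the class of a point of
     [D]. *)
  have Dn : D n by move: (DX _ _ xgn); rewrite Dx /g; case: ifP => // ->.
  by rewrite -gE //; apply/evenR.
have returns y : exists m, odd (iter m.+1 f (2 * y + 1)).
  have [//|/forallNP stay] := pselect (exists m, odd (iter m.+1 f (2 * y + 1))).
  have ev m : ~~ odd (iter m.+1 f (2 * y + 1)) by apply/negP.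
  have fE := evenE _ (ev 0).
  have Dy : D (f (2 * y + 1))./2.
    by apply/DP => n; rewrite [2 * _]fE -iterSr.
  (* An orbit staying even would give [f (2 * y + 1)] and some [f (2 * n)] the same class, hence
     also [2 * y + 1] and [2 * n], against parity. *)
  have [n] := ontoD _ Dy; rewrite [2 * _./2]fE => /(fP _ _).2/ujoin_odd.
  by rewrite odd1 (negPf (even0 n)).
(* The first return time is [(r y).+1]; the shift excludes the odd starting point itself. *)
pose r y := ex_minn (returns y).
have r_odd y : odd (iter (r y).+1 f (2 * y + 1)) by rewrite /r; case: ex_minnP.
have r_min y m : odd (iter m.+1 f (2 * y + 1)) -> r y <= m.
  by rewrite /r; case: ex_minnP => k _; apply.
pose h y := (iter (r y).+1 f (2 * y + 1))./2.
have hE y : 2 * h y + 1 = iter (r y).+1 f (2 * y + 1) by exact: oddE.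
have rY x y : Y x y -> r x = r y.
  move=> /succR xy; have E n := ujoin_odd (iterR n.+1 _ _ xy).
  by apply/eqP; rewrite eqn_leq !r_min // ?E // -E.
have cancelR n a b : R (iter n f a) (iter n f b) -> R a b.
  exact: (reduction_iter n _ _ fR).2.
have h_inj x y : r x <= r y -> Y (h x) (h y) -> Y x y.
  move=> le_r /succR; rewrite !hE.
  (* Cancelling [(r x).+1] steps relates [2 * x + 1] to the point at time [r y - r x] of the orbit
     of [2 * y + 1]. That point is odd, so a positive difference would be a return before the first
     one. *)
  rewrite -(subnKC le_r) -addSn iterD => /cancelR xy.
  move: (ujoin_odd xy); rewrite odd1 => /esym.
  case E: (r y - r x) xy => [|k] xy; first by move=> _; apply/succR.
  by move=> /r_min; lia.
have hR : reduction h Y Y.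
  split.
    apply/computable_half/computable_iter => //; last first.
      rewrite -[X in computable X]/(fun v => 2 * thead v + 1).
      have := computable_S (computable_mul2n (computable_thead 0)).
      by congr computable; apply: funext => v; rewrite addn1.
    apply: computable_S.
    pose t (v : 2.-tuple nat) := odd (iter (thead v).+1 f
      (2 * thead (behead_tuple v)).+1).
    (* Unbounded search for [r y], with the candidate in the head of [v]; it always succeeds by
       [returns]. *)
    apply: (@computable_mu 1 (fun v => ~~ t v : nat)).
    - apply/computable_negb/computable_odd/computable_iter => //.
        exact: computable_S (computable_thead _).
      apply/computable_S/computable_mul2n.
      exact: computable_behead (computable_thead _).
    - by move=> v; have := r_odd (thead v); rewrite /t addn1 theadE behead_tuple_cons => ->.
    - move=> v m lt_m; have := @r_min (thead v) m.
      rewrite /t addn1 theadE behead_tuple_cons.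
      by case: odd => // /(_ isT); lia.
  move=> x y; split=> [xy|].
    by apply/succR; rewrite !hE (rY _ _ xy); apply/iterR/succR.
  case: (leqP (r x) (r y)) => [|/ltnW] le_r; first exact: h_inj.
  by case: eqY => _ sY _ /sY /(h_inj _ _ le_r) /sY.
have ontoY y : exists z, R (2 * y + 1) (iter (r z).+1 f (2 * z + 1)).
  by have [z yz] := sfY _ hR y; exists z; rewrite -hE; apply/succR.
move=> a; case: (boolP (odd a)) => [/oddE <-|/evenE <-].
  by have [z yz] := ontoY a./2; exists (iter (r z) f (2 * z + 1)).
move: a./2 => {}a.
have [/ontoD[n an]|ND] := boolP (D a); first by exists (2 * n).
have exits : exists n, odd (iter n f (2 * a)).
  by apply: contrapT => /forallNP ev; case/negP: ND; apply/DP => n; apply/negP.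
case: (ex_minnP exits) => n odd_n min_n.
have [z] := ontoY (iter n f (2 * a))./2; rewrite oddE // => nz.
(* Both orbits meet the same class, after [n] and [(r z).+1] steps. If [n <= r z], cancelling [n]
   steps leaves at least one application of [f] on the right, which gives the preimage. *)
case: (leqP n (r z)) => [le_n|lt_r].
  exists (iter (r z - n) f (2 * z + 1)); apply: (cancelR n).
  by rewrite -iterS -iterD addnS subnKC.
(* Otherwise the orbit of [2 * a] would already be odd at time n - r z - 1 *)
move: nz; rewrite -(subnKC lt_r) iterD => /cancelR/ujoin_odd.
by rewrite odd1 => /min_n; lia.
Qed.
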